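(* Let $\alpha>0$. (i) If $0<\beta<1/2$ and $\tanh\big(\frac{\pi\alpha}{3}\big)=\sqrt{3}\,\tan\big(\frac{\pi\beta}{3}\big)$, then \[ \prod_{n=1}^\infty\left(\frac{n^2(n^2+\alpha^2)^2}{(n^2-\beta^2)^2(n^2-4\beta^2)}\right)^{n\left(\frac{n}{3}\right)}=e^{4\pi\alpha\beta/3}. \] (ii) If $0<\beta<1$ and $\tan\big(\frac{\pi\beta}{3}\big)=\sqrt{3}\,\tanh\big(\frac{\pi\alpha}{3}\big)$, then \[ \prod_{n=1}^\infty\left(\frac{n^2(n^2-\beta^2)^2}{(n^2+\alpha^2)^2(n^2+4\alpha^2)}\right)^{n\left(\frac{n}{3}\right)}=e^{-4\pi\alpha\beta/3}. \]
   Context: $\left(\frac{n}{3}\right)$ is the Legendre symbol modulo $3$: it equals $1$ if $n\equiv1$, $-1$ if $n\equiv 2$, and $0$ if $n\equiv 0\pmod 3$. In the products, $n\left(\frac n3\right)$ is the exponent. The infinite products are limits of the partial products $\prod_{n=1}^N$ as $N\to\infty$. *)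

(* Defs.v *)
From Stdlib Require Import Reals ZArith.
From Coquelicot Require Import Coquelicot.
Open Scope R_scope.

(** The Legendre symbol modulo 3 on the naturals. *)
Definition legendre3 (n : nat) : Z :=
  match Nat.modulo n 3 with
  | 1%nat => 1%Z
  | 2%nat => (-1)%Z
  | _ => 0%Z
  end.

(** [partial_prod f N] is the product of [f n] over [1 <= n <= N]; unlike in
    [prod_f_R0], the factor [f 0] is absent and [N = 0] gives the empty product. *)
Fixpoint partial_prod (f : nat -> R) (N : nat) : R :=
  match N with
  | O => 1
  | S M => partial_prod f M * f (S M)
  end.

Definition is_infinite_prod (f : nat -> R) (l : R) : Prop :=
  is_lim_seq (partial_prod f) l.

(* Main.v *)
Require Import Defs.
From Stdlib Require Import Reals ZArith Lra Lia.
From Coquelicot Require Import Coquelicot.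
Open Scope R_scope.

(** Write [chi] for the Legendre symbol modulo 3 and put
    [f_N(s) = sum_(n <= N) n chi(n) ln (1 - s / n^2)].  The logarithms of the
    partial products are [2 f_N(-a^2) - 2 f_N(b^2) - f_N(4 b^2)] in the first
    part and [2 f_N(b^2) - 2 f_N(-a^2) - f_N(-4 a^2)] in the second.

    The limits of the [f_N] are dilogarithm-like, but the derivative of [f_N]
    is minus [sum_(n <= N) chi(n) n / (n^2 - s)], whose limit is elementary:
    [(PI / sqrt 3) / (1 + 2 cos (2 PI x / 3))] for [s = x^2] with [0 < x < 1],
    and the same with [cosh] for [s = - x^2] ([polesum_trig],
    [polesum_hyperbolic]).  This is a Fourier series evaluation.  If [g] solves
    [g'' = - s g] with [g PI = 0], its sine coefficients are proportional to
    [n / (n^2 - s)], and the kernel [sum chi(n) sin (n t)] is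
    [- sin (3 M t) / (1 + 2 cos t)] when the sum stops at [3 M]; the
    Riemann-Lebesgue lemma then leaves only the contribution of the zero
    [t = 2 PI / 3] of the denominator ([polesum_mul_limit]).

    The constraint between [a] and [b] is [tan (PI b / 3) = K tanh (PI a / 3)]
    with [K = 1 / sqrt 3] in the first part and [K = sqrt 3] in the second.  It
    defines a curve [b = b(a)] from the origin, along which both sides of the
    claim, after taking logarithms, start at [0].  Their derivatives agree:
    with [sigma(s)] the limit of the sum above, the first constraint gives
    [sigma(-a^2) = (PI / 3) b'] and
    [b' (sigma(b^2) + 2 sigma(4 b^2)) = PI / 3], so the derivative of the left
    side is [(4 PI / 3) (a b' + b)]; the second constraint is similar.

    Dirichlet's test with an explicit remainder ([chi_tail_bound],
    [polesum_tail]) makes the convergence of the derivatives uniform along the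
    curve, and the mean value theorem carries it over to the logarithms of the
    products ([primitive_limit]). *)

(** * The character modulo 3 and tails of its series *)
Definition chi (n : nat) : R := IZR (legendre3 n).

Lemma chi_3k (k : nat) : chi (3 * k) = 0.
Proof.
  unfold chi, legendre3.
  replace (Nat.modulo (3 * k) 3) with 0%nat; [reflexivity|].
  now rewrite Nat.mul_comm, Nat.Div0.mod_mul.
Qed.

Lemma chi_3k1 (k : nat) : chi (S (3 * k)) = 1.
Proof.
  unfold chi, legendre3.
  replace (Nat.modulo (S (3 * k)) 3) with 1%nat; [reflexivity|].
  replace (S (3 * k)) with (1 + k * 3)%nat by lia.
  now rewrite Nat.Div0.mod_add.
Qed.

Lemma chi_3k2 (k : nat) : chi (S (S (3 * k))) = -1.
Proof.
  unfold chi, legendre3.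
  replace (Nat.modulo (S (S (3 * k))) 3) with 2%nat; [reflexivity|].
  replace (S (S (3 * k))) with (2 + k * 3)%nat by lia.
  now rewrite Nat.Div0.mod_add.
Qed.

Lemma sum_3S (f : nat -> R) (k : nat) :
  sum_f_R0 f (3 * S k) =
  sum_f_R0 f (3 * k) + f (S (3 * k)) + f (S (S (3 * k))) + f (3 * S k)%nat.
Proof.
  replace (3 * S k)%nat with (S (S (S (3 * k)))) by lia. reflexivity.
Qed.

Lemma sum_chi_bounds (N : nat) : 0 <= sum_f_R0 chi N <= 1.
Proof.
  assert (H3 : forall k, sum_f_R0 chi (3 * k) = 0).
  { induction k as [|k IH]; [exact (chi_3k 0)|].
    rewrite sum_3S, IH, chi_3k, chi_3k1, chi_3k2. ring. }
  assert (HN := Nat.div_mod_eq N 3).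
  assert (Hr := Nat.mod_upper_bound N 3 ltac:(lia)).
  set (k := (N / 3)%nat) in *.
  destruct (Nat.modulo N 3) as [|[|[|r]]]; [| | |lia]; rewrite HN.
  - rewrite Nat.add_0_r, H3. lra.
  - replace (3 * k + 1)%nat with (S (3 * k)) by lia.
    rewrite tech5, H3, chi_3k1. lra.
  - replace (3 * k + 2)%nat with (S (S (3 * k))) by lia.
    rewrite !tech5, H3, chi_3k1, chi_3k2. lra.
Qed.

(** Dirichlet's test in quantitative form.  Since the partial sums [X_n] of
    [chi] are [0] or [1], summation by parts turns the tail into a telescoping
    sum of decrements of [c]; the error is the first omitted coefficient, which
    gives the uniformity in the parameter needed later. *)
Lemma chi_tail_bound (c : nat -> R) (N M : nat) :
  (N <= M)%nat ->
  (forall n, (N < n)%nat -> 0 <= c n) ->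
  (forall n, (N < n)%nat -> c (S n) <= c n) ->
  Rabs (sum_f_R0 (fun n => chi n * c n) M - sum_f_R0 (fun n => chi n * c n) N)
    <= c (S N).
Proof.
  intros HNM Hpos Hdec.
  destruct (Nat.eq_dec N M) as [->|Hne].
  { rewrite Rminus_diag, Rabs_R0. apply Hpos; lia. }
  set (T := fun m => sum_f_R0 (fun n => chi n * c n) m
                     - sum_f_R0 (fun n => chi n * c n) N).
  (* Summation by parts, arranged as an invariant of the upper end of the sum. *)
  assert (Hinv : forall k, let m := (S N + k)%nat in
    - c (S N) <= T m - sum_f_R0 chi m * c m <= c (S N) - c m).
  { induction k as [|k IH]; cbv zeta in *.
    - rewrite Nat.add_0_r. unfold T. rewrite !tech5.
      assert (HX := sum_chi_bounds N).
      assert (Hc := Hpos (S N) ltac:(lia)). nra.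
    - replace (S N + S k)%nat with (S (S N + k)) by lia.
      unfold T in *. rewrite !tech5.
      assert (HX := sum_chi_bounds (S N + k)).
      assert (Hd := Hdec (S N + k)%nat ltac:(lia)).
      generalize dependent (S N + k)%nat. intros m. intros. nra. }
  specialize (Hinv (M - S N)%nat). cbv zeta in Hinv.
  replace (S N + (M - S N))%nat with M in Hinv by lia.
  assert (HX := sum_chi_bounds M). assert (Hc := Hpos M ltac:(lia)).
  fold (T M). apply Rabs_le. nra.
Qed.

(** * The Riemann-Lebesgue lemma for continuous functions *)

Lemma bounded_on_segment (q : R -> R) (a b : R) : a <= b ->
  (forall t, a <= t <= b -> continuous q t) ->
  exists B, 0 <= B /\ forall t, a <= t <= b -> Rabs (q t) <= B.
Proof.
  intros Hab Hq.
  destruct (continuity_ab_maj (fun t => Rabs (q t)) a b Hab) as [t0 [Ht0 _]].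
  { intros t Ht. apply continuity_pt_filterlim.
    apply (continuous_comp q Rabs); [now apply Hq | apply continuous_Rabs]. }
  exists (Rabs (q t0)). split; [apply Rabs_pos | assumption].
Qed.

Lemma continuous_sin_lin (w t : R) : continuous (fun t => sin (w * t)) t.
Proof.
  apply (ex_derive_continuous (V := R_NormedModule)). auto_derive. auto.
Qed.

(** Translating by the half-period [PI / n] flips the sign of [sin (n t)], so
    twice the integral is the integral of [(q t - q (t + PI / n)) sin (n t)] up
    to two boundary pieces of length [PI / n]; uniform continuity finishes.
    The translation is why [q] has to be continuous slightly beyond [b]. *)
Lemma riemann_lebesgue (q : R -> R) (a b : R) : a <= b ->
  (forall t, a <= t <= b + 1 -> continuous q t) ->
  is_lim_seq (fun n => RInt (fun t => q t * sin (INR n * t)) a b) 0.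
Proof.
  intros Hab Hq.
  destruct (bounded_on_segment q a (b + 1) ltac:(lra) Hq) as [B [HB HqB]].
  assert (Huc : uniform_continuity q (fun t => a <= t <= b + 1)).
  { apply Heine; [apply compact_P3|].
    intros t Ht. apply continuity_pt_filterlim. now apply Hq. }
  apply is_lim_seq_spec. intros eps.
  assert (He := cond_pos eps).
  set (e1 := pos eps / (b - a + 1)).
  assert (He1 : 0 < e1) by (apply Rdiv_lt_0_compat; lra).
  destruct (Huc (mkposreal e1 He1)) as [del Hdel]. simpl in Hdel.
  assert (Hdp := cond_pos del).
  assert (Hh : is_lim_seq (fun n => PI / INR n) 0).
  { apply is_lim_seq_ext with (fun n => PI * / INR n); [reflexivity|].
    replace (Finite 0) with (Rbar_mult (Finite PI) (Finite 0))
      by (simpl; f_equal; ring).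
    apply is_lim_seq_scal_l.
    replace (Finite 0) with (Rbar_inv p_infty) by reflexivity.
    apply is_lim_seq_inv; [apply is_lim_seq_INR | discriminate]. }
  set (e2 := Rmin 1 (Rmin (pos del) (pos eps / (2 * B + 1)))).
  assert (He2 : 0 < e2).
  { unfold e2. repeat apply Rmin_pos; try lra. apply Rdiv_lt_0_compat; lra. }
  apply is_lim_seq_spec in Hh. destruct (Hh (mkposreal e2 He2)) as [N HN].
  simpl in HN.
  exists (S N). intros n Hn.
  assert (Hn0 : 0 < INR n) by (apply lt_0_INR; lia).
  specialize (HN n ltac:(lia)).
  set (h := PI / INR n) in *.
  assert (Hh0 : 0 < h) by (apply Rdiv_lt_0_compat; [apply PI_RGT_0|lra]).
  rewrite Rminus_0_r, Rabs_pos_eq in HN by lra.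
  assert (Hh1 : h < 1 /\ h < del /\ h < eps / (2 * B + 1)).
  { unfold e2 in HN. assert (M1 := Rmin_l 1 (Rmin (pos del) (pos eps / (2 * B + 1)))).
    assert (M2 := Rmin_r 1 (Rmin (pos del) (pos eps / (2 * B + 1)))).
    assert (M3 := Rmin_l (pos del) (pos eps / (2 * B + 1))).
    assert (M4 := Rmin_r (pos del) (pos eps / (2 * B + 1))). lra. }
  destruct Hh1 as [Hh1 [Hhd Hhe]].
  set (F := fun t => q t * sin (INR n * t)).
  assert (HFc : forall t, a <= t <= b + 1 -> continuous F t).
  { intros t Ht. apply (continuous_mult q (fun t => sin (INR n * t)));
      [now apply Hq | apply continuous_sin_lin]. }
  assert (HFi : forall u v, a <= u <= v -> v <= b + 1 -> ex_RInt F u v).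
  { intros u v Hu Hv. apply (ex_RInt_continuous (V := R_CompleteNormedModule)).
    intros t. rewrite Rmin_left, Rmax_right by lra. intros. apply HFc. lra. }
  assert (HFb : forall t, a <= t <= b + 1 -> Rabs (F t) <= B).
  { intros t Ht. unfold F. rewrite Rabs_mult.
    assert (Hs : Rabs (sin (INR n * t)) <= 1)
      by (apply Rabs_le; apply SIN_bound).
    assert (Hq1 := HqB t Ht). assert (Hq0 := Rabs_pos (q t)).
    assert (Hs0 := Rabs_pos (sin (INR n * t))). nra. }
  assert (Hshift : is_RInt (fun t => F (t + h)) a b (RInt F (a + h) (b + h))).
  { apply (is_RInt_ext (fun t => scal 1 (F (1 * t + h)))).
    - intros t _. change (1 * F (1 * t + h) = F (t + h)).
      rewrite !Rmult_1_l. reflexivity.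
    - apply (is_RInt_comp_lin F 1 h a b).
      rewrite !Rmult_1_l. apply (RInt_correct (V := R_CompleteNormedModule) F). apply HFi; lra. }
  assert (Hsum : is_RInt (fun t => F t + F (t + h)) a b
                   (RInt F a b + RInt F (a + h) (b + h))).
  { apply (is_RInt_plus (V := R_NormedModule)); [|exact Hshift].
    apply (RInt_correct (V := R_CompleteNormedModule) F). apply HFi; lra. }
  assert (Hpt : forall t, a <= t <= b -> Rabs (F t + F (t + h)) <= e1).
  { intros t Ht. unfold F.
    replace (INR n * (t + h)) with (INR n * t + PI)
      by (unfold h; field; lra).
    rewrite neg_sin.
    replace (_ + _) with ((q t - q (t + h)) * sin (INR n * t)) by ring.
    rewrite Rabs_mult.
    assert (Hs : Rabs (sin (INR n * t)) <= 1)
      by (apply Rabs_le; apply SIN_bound).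
    assert (Hs0 := Rabs_pos (sin (INR n * t))).
    assert (Hd : Rabs (q t - q (t + h)) < e1).
    { apply Hdel; try lra.
      replace (t - (t + h)) with (- h) by ring. rewrite Rabs_Ropp, Rabs_pos_eq; lra. }
    assert (Hd0 := Rabs_pos (q t - q (t + h))). nra. }
  assert (H1 : Rabs (RInt F a b + RInt F (a + h) (b + h)) <= (b - a) * e1).
  { apply (norm_RInt_le_const (fun t => F t + F (t + h)) a b); auto. }
  assert (H2 : Rabs (RInt F a (a + h)) <= h * B).
  { replace (h * B) with ((a + h - a) * B) by ring.
    apply (norm_RInt_le_const F a (a + h)); [lra| |].
    - intros t Ht. apply HFb. lra.
    - apply (RInt_correct (V := R_CompleteNormedModule) F). apply HFi; lra. }
  assert (H3 : Rabs (RInt F b (b + h)) <= h * B).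
  { replace (h * B) with ((b + h - b) * B) by ring.
    apply (norm_RInt_le_const F b (b + h)); [lra| |].
    - intros t Ht. apply HFb. lra.
    - apply (RInt_correct (V := R_CompleteNormedModule) F). apply HFi; lra. }
  assert (HC1 : RInt F a b + RInt F b (b + h) = RInt F a (b + h))
    by (apply (RInt_Chasles F); apply HFi; lra).
  assert (HC2 : RInt F a (a + h) + RInt F (a + h) (b + h) = RInt F a (b + h)).
  { apply (RInt_Chasles F); apply HFi; lra. }
  rewrite Rminus_0_r.
  assert (HA : (b - a) * e1 < eps).
  { unfold e1. apply Rmult_lt_reg_r with (b - a + 1); [lra|].
    field_simplify; [|lra]. nra. }
  assert (HBh : h * (2 * B + 1) < eps).
  { apply Rmult_lt_compat_r with (r := 2 * B + 1) in Hhe; [|lra].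
    unfold Rdiv in Hhe. rewrite Rmult_assoc, Rinv_l in Hhe; lra. }
  apply Rabs_le_between in H1, H2, H3. fold F.
  apply Rabs_def1; nra.
Qed.

(** * Removable singularities *)

Definition slope (f : R -> R) (c d t : R) : R :=
  if Req_dec_T t c then d else (f t - f c) / (t - c).

Lemma slope_mul (f : R -> R) (c d t : R) :
  f t - f c = slope f c d t * (t - c).
Proof.
  unfold slope. destruct (Req_dec_T t c) as [->|H]; [ring | field; lra].
Qed.

Lemma continuous_slope (f : R -> R) (c d t : R) :
  is_derive f c d -> continuous f t -> continuous (slope f c d) t.
Proof.
  intros Hd Hf. destruct (Req_dec_T t c) as [->|Hne].
  - apply continuity_pt_filterlim.
    apply is_derive_Reals in Hd.
    intros eps Heps. destruct (Hd eps Heps) as [del Hdel].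
    exists (pos del). split; [apply cond_pos|].
    intros x [_ Hx]. simpl in *. unfold R_dist in *. unfold slope.
    destruct (Req_dec_T c c) as [_|]; [|lra].
    destruct (Req_dec_T x c) as [->|Hxc]; [now rewrite Rminus_diag, Rabs_R0|].
    specialize (Hdel (x - c) ltac:(lra) Hx).
    replace (c + (x - c)) with x in Hdel by ring. exact Hdel.
  - apply continuous_ext_loc with (fun u => (f u - f c) / (u - c)).
    + assert (Hp : 0 < Rabs (t - c)) by (apply Rabs_pos_lt; lra).
      exists (mkposreal _ Hp). intros u Hu. unfold slope.
      destruct (Req_dec_T u c) as [->|]; [|reflexivity].
      exfalso. revert Hu. change (~ Rabs (c - t) < Rabs (t - c)).
      rewrite Rabs_minus_sym. lra.
    + apply (continuous_mult (fun u => f u - f c) (fun u => / (u - c))).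
      * apply (continuous_minus f (fun _ => f c)); [exact Hf | apply continuous_const].
      * apply continuous_Rinv_comp; [|lra].
        apply (continuous_minus (fun u => u) (fun _ => c));
          [apply continuous_id | apply continuous_const].
Qed.

(** Both functions vanish at [c], so their quotient is the quotient of their
    slopes, which stays continuous at [c] because the slope of [D] there is
    its nonzero derivative. *)
Lemma removable_quotient (r D : R -> R) (a b c r' D' : R) :
  is_derive r c r' -> is_derive D c D' -> r c = 0 -> D c = 0 -> D' <> 0 ->
  (forall t, a <= t <= b -> continuous r t /\ continuous D t) ->
  (forall t, a <= t <= b -> t <> c -> D t <> 0) ->
  exists q, (forall t, a <= t <= b -> continuous q t) /\
            (forall t, a <= t <= b -> r t = q t * D t).
Proof.
  intros Hr HD Hr0 HD0 HD' Hcont Hnz.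
  assert (Hs : forall t, a <= t <= b -> slope D c D' t <> 0).
  { intros t Ht H0. assert (H := slope_mul D c D' t).
    rewrite H0, HD0 in H. destruct (Req_dec_T t c) as [->|Hne].
    - unfold slope in H0. destruct (Req_dec_T c c); lra.
    - apply (Hnz t Ht Hne). lra. }
  exists (fun t => slope r c r' t / slope D c D' t). split; intros t Ht.
  - apply (continuous_mult (slope r c r') (fun t => / slope D c D' t)).
    + now apply continuous_slope; [|apply Hcont].
    + apply continuous_Rinv_comp; [|now apply Hs].
      now apply continuous_slope; [|apply Hcont].
  - assert (H1 := slope_mul r c r' t). assert (H2 := slope_mul D c D' t).
    rewrite Hr0 in H1. rewrite HD0 in H2.
    replace (r t) with (slope r c r' t * (t - c)) by lra.
    replace (D t) with (slope D c D' t * (t - c)) by lra.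
    field. now apply Hs.
Qed.

(** * Evaluation of the sum of chi(n) n / (n^2 - s) *)

Lemma PI_gt_3 : 3 < PI.
Proof. assert (H := PI2_3_2). lra. Qed.

(** The next zero of [1 + 2 cos t] is [4 PI / 3], and it lies beyond [PI + 1]
    because [PI > 3]: this leaves room for the translations in
    [riemann_lebesgue]. *)
Lemma two_cos_nonzero (t : R) :
  0 <= t <= PI + 1 -> t <> 2 * PI / 3 -> 1 + 2 * cos t <> 0.
Proof.
  intros Ht Hne H0. assert (HPI := PI_gt_3).
  assert (Hc : cos t - cos (2 * (PI / 3)) = 0) by (rewrite cos_2PI3; lra).
  rewrite form2 in Hc.
  assert (H1 : 0 < sin ((t + 2 * (PI / 3)) / 2)) by (apply sin_gt_0; lra).
  assert (H2 : sin ((t - 2 * (PI / 3)) / 2) <> 0).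
  { destruct (Rtotal_order t (2 * (PI / 3))) as [Hlt|[Heq|Hgt]].
    - apply Rlt_not_eq. apply sin_lt_0_var; lra.
    - lra.
    - apply Rgt_not_eq. apply sin_gt_0; lra. }
  assert (H3 := Rmult_integral_contrapositive_currified _ _ H2 (Rgt_not_eq _ _ H1)).
  lra.
Qed.

Definition kernel (M : nat) (t : R) : R :=
  sum_f_R0 (fun n => chi n * sin (INR n * t)) (3 * M).

(** The counterpart of the closed form of the Dirichlet kernel.  The factor
    [1 + 2 cos t] replaces each [sin (n t)] by three consecutive sines, hence
    [chi n] by [chi (n-1) + chi n + chi (n+1) = 0], and only the end of the sum
    survives. *)
Lemma kernel_closed (M : nat) (t : R) :
  (1 + 2 * cos t) * kernel M t = - sin (INR (3 * M) * t).
Proof.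
  unfold kernel. induction M as [|M IH].
  - change (INR (3 * 0)) with 0. rewrite Rmult_0_l, sin_0.
    change (sum_f_R0 _ _) with (chi 0 * sin (INR 0 * t)).
    change (chi 0) with 0. ring.
  - rewrite sum_3S, chi_3k, chi_3k1, chi_3k2.
    replace (3 * S M)%nat with (S (S (S (3 * M)))) by lia.
    rewrite !S_INR. set (A := INR (3 * M) * t) in *.
    set (B := (INR (3 * M) + 1) * t). set (C := (INR (3 * M) + 1 + 1) * t).
    replace ((INR (3 * M) + 1 + 1 + 1) * t) with (C + t) by (unfold C; ring).
    assert (HA : sin A = sin B * cos t - cos B * sin t).
    { rewrite <- sin_minus. f_equal. unfold A, B. ring. }
    assert (HB : sin B = sin C * cos t - cos C * sin t).
    { rewrite <- sin_minus. f_equal. unfold B, C. ring. }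
    assert (HC : sin C = sin B * cos t + cos B * sin t).
    { rewrite <- sin_plus. f_equal. unfold B, C. ring. }
    rewrite sin_plus. rewrite HA in IH. set (sm := sum_f_R0 _ _) in *. lra.
Qed.

(** Integrating by parts twice reproduces the integral multiplied by [s / n^2];
    solving for it leaves the boundary terms. *)
Lemma sine_coefficient (g g' : R -> R) (s : R) (n : nat) :
  (forall t, is_derive g t (g' t)) ->
  (forall t, is_derive g' t (- s * g t)) ->
  g PI = 0 -> INR n ^ 2 <> s ->
  is_RInt (fun t => g t * sin (INR n * t)) 0 PI (g 0 * (INR n / (INR n ^ 2 - s))).
Proof.
  intros Hg Hg' HPI Hn.
  set (P := fun t => (g' t * sin (INR n * t) - INR n * g t * cos (INR n * t))
                     / (INR n ^ 2 - s)).
  replace (g 0 * (INR n / (INR n ^ 2 - s))) with (minus (P PI) (P 0)).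
  - apply (is_RInt_derive P).
    + intros t _. unfold P.
      evar_last.
      * auto_derive; [|reflexivity].
        split; [eexists; apply Hg' |].
        split; [eexists; apply Hg | auto].
      * replace (Derive (fun x : R => g x) t) with (g' t)
          by (symmetry; apply is_derive_unique, Hg).
        replace (Derive (fun x : R => g' x) t) with (- s * g t)
          by (symmetry; apply is_derive_unique, Hg').
        field. lra.
    + intros t _. apply (continuous_mult g (fun t => sin (INR n * t))).
      * apply (ex_derive_continuous (V := R_NormedModule)). eexists; apply Hg.
      * apply continuous_sin_lin.
  - change (P PI - P 0 = g 0 * (INR n / (INR n ^ 2 - s))).
    unfold P. rewrite HPI, Rmult_0_r, sin_0, cos_0.
    replace (sin (INR n * PI)) with 0; [field; lra|].
    symmetry. apply sin_eq_0_1. exists (Z.of_nat n). now rewrite INR_IZR_INZ.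
Qed.

Lemma sine_coefficient_1 :
  is_RInt (fun t => sin t * sin (INR 1 * t)) 0 PI (PI / 2).
Proof.
  set (P := fun t => (t - sin t * cos t) / 2).
  replace (PI / 2) with (minus (P PI) (P 0)).
  - apply (is_RInt_derive P).
    + intros t _. unfold P. auto_derive; [auto|]. simpl.
      rewrite !Rmult_1_l. assert (H := sin2_cos2 t). unfold Rsqr in H. lra.
    + intros t _. apply (continuous_mult sin (fun t => sin (INR 1 * t))).
      * apply continuous_sin.
      * apply continuous_sin_lin.
  - change (P PI - P 0 = PI / 2). unfold P. rewrite sin_PI, sin_0. lra.
Qed.

Lemma is_RInt_sum (f : nat -> R -> R) (l : nat -> R) (a b : R) (N : nat) :
  (forall n, (n <= N)%nat -> is_RInt (f n) a b (l n)) ->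
  is_RInt (fun t => sum_f_R0 (fun n => f n t) N) a b (sum_f_R0 l N).
Proof.
  induction N as [|N IH]; intros H; simpl.
  - apply H; lia.
  - apply (is_RInt_plus (V := R_NormedModule)); [apply IH; intros; apply H; lia|].
    apply H; lia.
Qed.

(** The logarithmic derivative, in the variable [s] and up to sign, of the
    partial products of [(1 - s / n^2) ^ (n chi n)].  Taking [s] rather than
    its square root as parameter treats the trigonometric ([s > 0]) and the
    hyperbolic ([s < 0]) case together. *)
Definition polesum (N : nat) (s : R) : R :=
  sum_f_R0 (fun n => chi n * (INR n / (INR n ^ 2 - s))) N.

Lemma is_RInt_kernel (f : R -> R) (l : nat -> R) (M : nat) :
  (forall n, (0 < n)%nat -> is_RInt (fun t => f t * sin (INR n * t)) 0 PI (l n)) ->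
  is_RInt (fun t => f t * kernel M t) 0 PI (sum_f_R0 (fun n => chi n * l n) (3 * M)).
Proof.
  intros H.
  apply (is_RInt_ext (fun t => sum_f_R0 (fun n => chi n * (f t * sin (INR n * t))) (3 * M))).
  - intros t _. unfold kernel. rewrite scal_sum. apply sum_eq. intros; ring.
  - apply is_RInt_sum. intros [|n] _.
    + replace (chi 0 * l 0%nat) with (scal (PI - 0) 0).
      * apply (is_RInt_ext (fun _ => 0)); [|apply (is_RInt_const (V := R_NormedModule))].
        intros. simpl. change (chi 0) with 0. ring.
      * change ((PI - 0) * 0 = chi 0 * l 0%nat). change (chi 0) with 0. ring.
    + apply (is_RInt_scal (V := R_NormedModule) (fun t => f t * sin (INR (S n) * t))).
      apply H; lia.
Qed.

Lemma sum_single (l : R) (N : nat) :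
  sum_f_R0 (fun n => chi n * (if Nat.eqb n 1 then l else 0)) (S N) = l.
Proof.
  induction N as [|N IH].
  - simpl. change (chi 0) with 0. change (chi 1) with 1. ring.
  - rewrite tech5, IH. simpl. ring.
Qed.

(** By [sine_coefficient] the left side is the integral of [g] against the
    kernel.  The kernel concentrates at [2 PI / 3], where [1 + 2 cos t]
    vanishes: once a multiple of [sin t] is subtracted so that the remainder
    [r] vanishes there, [r] is divisible by [1 + 2 cos t] and contributes
    nothing in the limit by [riemann_lebesgue].  The integral of [sin t]
    against the kernel is [PI / 2] by orthogonality. *)
Theorem polesum_mul_limit (g g' : R -> R) (s : R) :
  (forall t, is_derive g t (g' t)) ->
  (forall t, is_derive g' t (- s * g t)) ->
  g PI = 0 -> s < 1 ->
  is_lim_seq (fun M => g 0 * polesum (3 * M) s) (PI * g (2 * PI / 3) / sqrt 3).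
Proof.
  intros Hg Hg' HPI Hs.
  set (th := 2 * PI / 3).
  assert (H3 : sqrt 3 * sqrt 3 = 3) by (apply sqrt_sqrt; lra).
  assert (H3p : 0 < sqrt 3) by (apply sqrt_lt_R0; lra).
  assert (Hsin : sin th = sqrt 3 / 2).
  { unfold th. replace (2 * PI / 3) with (2 * (PI / 3)) by field. apply sin_2PI3. }
  assert (Hcos : cos th = -1 / 2).
  { unfold th. replace (2 * PI / 3) with (2 * (PI / 3)) by field. apply cos_2PI3. }
  (* Chosen so that [g t - lam * sin t] vanishes at [th]. *)
  set (lam := g th / (sqrt 3 / 2)).
  set (r := fun t => g t - lam * sin t).
  set (D := fun t => 1 + 2 * cos t).
  assert (Hgc : forall t, continuous g t).
  { intros t. apply (ex_derive_continuous (V := R_NormedModule)). eexists; apply Hg. }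
  destruct (removable_quotient r D 0 (PI + 1) th (g' th - lam * cos th)
              (- 2 * sin th)) as [q [Hqc Hq]].
  - apply (is_derive_minus g (fun t => lam * sin t)); [apply Hg|].
    auto_derive; [auto|ring].
  - unfold D. auto_derive; [auto|ring].
  - unfold r, lam. rewrite Hsin. field. lra.
  - unfold D. rewrite Hcos. field.
  - rewrite Hsin. lra.
  - intros t _. split.
    + apply (continuous_minus g (fun t => lam * sin t)); [apply Hgc|].
      apply (ex_derive_continuous (V := R_NormedModule)). auto_derive. auto.
    + apply (ex_derive_continuous (V := R_NormedModule)). unfold D. auto_derive. auto.
  - intros t Ht Hne. now apply two_cos_nonzero.
  - assert (HP := PI_gt_3).
    assert (HRL := riemann_lebesgue q 0 PI ltac:(lra) Hqc).
    assert (Hval : forall M, (0 < M)%nat ->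
      RInt (fun t => q t * sin (INR (3 * M) * t)) 0 PI
        = lam * (PI / 2) - g 0 * polesum (3 * M) s).
    { intros M HM. apply is_RInt_unique.
      assert (HK : is_RInt (fun t => r t * kernel M t) 0 PI
                     (g 0 * polesum (3 * M) s - lam * (PI / 2))).
      { apply (is_RInt_ext (fun t => g t * kernel M t - lam * (sin t * kernel M t))).
        { intros t _. unfold r. simpl. lra. }
        apply (is_RInt_minus (V := R_NormedModule)).
        - unfold polesum. rewrite scal_sum.
          rewrite (sum_eq _ (fun n => chi n * (g 0 * (INR n / (INR n ^ 2 - s)))))
            by (intros; ring).
          apply is_RInt_kernel. intros n Hn. apply sine_coefficient with g'; auto.
          assert (1 <= INR n) by (apply (le_INR 1); lia). nra.
        - apply (is_RInt_scal (V := R_NormedModule) (fun t => sin t * kernel M t)).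
          destruct M as [|M]; [lia|].
          rewrite <- (sum_single (PI / 2) (S (S (3 * M)))).
          replace (S (S (S (3 * M)))) with (3 * S M)%nat by lia.
          apply is_RInt_kernel. intros n Hn.
          destruct (Nat.eqb_spec n 1) as [->|Hn1]; [apply sine_coefficient_1|].
          assert (Hn2 : 2 <= INR n) by (apply (le_INR 2); lia).
          replace 0 with (sin 0 * (INR n / (INR n ^ 2 - 1))) at 2
            by (rewrite sin_0; ring).
          (* Orthogonality of sines is [sine_coefficient] for [s = 1]. *)
          apply sine_coefficient with cos.
          + intros t. auto_derive; [auto|ring].
          + intros t. auto_derive; [auto|ring].
          + apply sin_PI.
          + nra. }
      replace (lam * (PI / 2) - g 0 * polesum (3 * M) s)
        with (opp (g 0 * polesum (3 * M) s - lam * (PI / 2)))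
        by (change (opp ?x) with (- x); simpl; lra).
      apply (is_RInt_ext (fun t => opp (r t * kernel M t)));
        [|now apply (is_RInt_opp (V := R_NormedModule))].
      intros t. rewrite Rmin_left, Rmax_right by lra. intros Ht.
      change (- (r t * kernel M t) = q t * sin (INR (3 * M) * t)).
      rewrite Hq by lra. assert (Hk := kernel_closed M t). unfold D.
      rewrite Rmult_assoc, Hk. ring. }
    assert (HRL3 : is_lim_seq (fun M => lam * (PI / 2) - g 0 * polesum (3 * M) s) 0).
    { apply is_lim_seq_ext_loc with
        (fun M => RInt (fun t => q t * sin (INR (3 * M) * t)) 0 PI).
      - exists 1%nat. intros M HM. apply Hval. lia.
      - apply (is_lim_seq_subseq
          (fun n => RInt (fun t => q t * sin (INR n * t)) 0 PI)
          0 (fun M => (3 * M)%nat)); [|exact HRL].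
        apply eventually_subseq. intros; lia. }
    apply is_lim_seq_ext with
      (fun M => lam * (PI / 2) - (lam * (PI / 2) - g 0 * polesum (3 * M) s)).
    { intros; ring. }
    replace (PI * g th / sqrt 3) with (lam * (PI / 2) - 0)
      by (unfold lam; field; lra).
    apply is_lim_seq_minus'; [apply is_lim_seq_const | exact HRL3].
Qed.

(** For [n >= - s] the coefficients [n / (n^2 - s)] decrease, so
    [chi_tail_bound] applies; it suffices to know the limit along the multiples
    of [3]. *)
Lemma polesum_tail (s L : R) (N : nat) :
  s < 1 -> - s <= INR (S N) ->
  is_lim_seq (fun M => polesum (3 * M) s) L ->
  Rabs (polesum N s - L) <= INR (S N) / (INR (S N) ^ 2 - s).
Proof.
  intros Hs HN Hlim.
  assert (Hge : forall n, (N < n)%nat -> 1 <= INR n /\ INR (S N) <= INR n).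
  { intros n Hn. split; [apply (le_INR 1) | apply le_INR]; lia. }
  assert (HM : forall M, (N <= 3 * M)%nat ->
    Rabs (polesum (3 * M) s - polesum N s) <= INR (S N) / (INR (S N) ^ 2 - s)).
  { intros M HM. unfold polesum.
    apply (chi_tail_bound (fun n => INR n / (INR n ^ 2 - s))); [exact HM| |];
      intros n Hn; destruct (Hge n Hn) as [H1 H2].
    - apply Rlt_le, Rdiv_lt_0_compat; nra.
    - rewrite S_INR. set (y := INR n) in *.
      assert (0 < y ^ 2 - s) by nra. assert (0 < (y + 1) ^ 2 - s) by nra.
      apply Rminus_le_0.
      replace (y / (y ^ 2 - s) - (y + 1) / ((y + 1) ^ 2 - s))
        with ((y * (y + 1) + s) / ((y ^ 2 - s) * ((y + 1) ^ 2 - s))) by (field; lra).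
      apply Rdiv_le_0_compat; nra. }
  rewrite Rabs_minus_sym.
  apply (is_lim_seq_le_loc (fun M => Rabs (polesum (3 * M) s - polesum N s))
           (fun _ => INR (S N) / (INR (S N) ^ 2 - s))
           (Rabs (L - polesum N s)) (INR (S N) / (INR (S N) ^ 2 - s))).
  - exists N. intros M HNM. apply HM. lia.
  - apply (is_lim_seq_abs (fun M => polesum (3 * M) s - polesum N s) (L - polesum N s)).
    apply is_lim_seq_minus'; [exact Hlim | apply is_lim_seq_const].
  - apply is_lim_seq_const.
Qed.

Lemma polesum_limit (g g' : R -> R) (s : R) :
  (forall t, is_derive g t (g' t)) ->
  (forall t, is_derive g' t (- s * g t)) ->
  g PI = 0 -> g 0 <> 0 -> s < 1 ->
  is_lim_seq (fun M => polesum (3 * M) s) (PI * g (2 * PI / 3) / (sqrt 3 * g 0)).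
Proof.
  intros Hg Hg' HPI H0 Hs.
  assert (H3p : 0 < sqrt 3) by (apply sqrt_lt_R0; lra).
  apply is_lim_seq_ext with (fun M => / g 0 * (g 0 * polesum (3 * M) s)).
  { intros M. field. exact H0. }
  replace (PI * g (2 * PI / 3) / (sqrt 3 * g 0))
    with (/ g 0 * (PI * g (2 * PI / 3) / sqrt 3)) by (field; lra).
  apply (is_lim_seq_scal_l _ (/ g 0) (PI * g (2 * PI / 3) / sqrt 3)).
  now apply polesum_mul_limit with g'.
Qed.

Definition trig_value (b : R) : R :=
  PI / (sqrt 3 * (1 + 2 * cos (2 * (PI * b / 3)))).

Definition hyp_value (a : R) : R :=
  PI / (sqrt 3 * (1 + 2 * cosh (2 * (PI * a / 3)))).

Lemma sqrt3_facts : 0 < sqrt 3 /\ sqrt 3 ^ 2 = 3.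
Proof. split; [apply sqrt_lt_R0; lra | apply pow2_sqrt; lra]. Qed.

(** Apply [polesum_limit] to [g t = sin (x (PI - t))], then use
    [sin (3 y) = sin y (1 + 2 cos (2 y))]. *)
Lemma polesum_trig (x : R) : 0 < x < 1 ->
  is_lim_seq (fun M => polesum (3 * M) (x ^ 2))
    (trig_value x).
Proof.
  intros Hx. unfold trig_value. assert (HPI := PI_gt_3).
  assert (H3p : 0 < sqrt 3) by (apply sqrt_lt_R0; lra).
  set (y := PI * x / 3).
  assert (Hs3 : sin (PI * x) = sin y * (1 + 2 * cos (2 * y))).
  { replace (PI * x) with (y + 2 * y) by (unfold y; field).
    rewrite sin_plus, sin_2a.
    assert (H := cos2 y). assert (Hc := cos_2a_cos y). unfold Rsqr in *. nra. }
  assert (H1 : 0 < sin (PI * x)) by (apply sin_gt_0; nra).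
  assert (H2 : 0 < sin y) by (apply sin_gt_0; unfold y; nra).
  assert (H4 : 1 + 2 * cos (2 * y) <> 0) by (intros H; rewrite H in Hs3; lra).
  replace (PI / (sqrt 3 * (1 + 2 * cos (2 * y))))
    with (PI * sin (x * (PI - 2 * PI / 3)) / (sqrt 3 * sin (x * (PI - 0)))).
  - apply (polesum_limit (fun t => sin (x * (PI - t)))
             (fun t => - x * cos (x * (PI - t)))).
    + intros t. auto_derive; [auto|]. unfold Rminus. ring.
    + intros t. auto_derive; [auto|]. unfold Rminus. ring.
    + rewrite Rminus_diag, Rmult_0_r. apply sin_0.
    + replace (x * (PI - 0)) with (PI * x) by ring. lra.
    + nra.
  - replace (x * (PI - 2 * PI / 3)) with y by (unfold y; field).
    replace (x * (PI - 0)) with (PI * x) by ring.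
    rewrite Hs3. field. lra.
Qed.

Lemma sinh_plus (u v : R) : sinh (u + v) = sinh u * cosh v + cosh u * sinh v.
Proof.
  unfold sinh, cosh. replace (- (u + v)) with (- u + - v) by ring.
  rewrite !exp_plus. field.
Qed.

Lemma cosh_double (u : R) : cosh (2 * u) = 2 * cosh u ^ 2 - 1.
Proof.
  unfold cosh. replace (2 * u) with (u + u) by ring.
  replace (- (u + u)) with (- u + - u) by ring. rewrite !exp_plus.
  assert (H : exp u * exp (- u) = 1)
    by (rewrite <- exp_plus, Rplus_opp_r; apply exp_0).
  field_simplify. lra.
Qed.

Lemma cosh_sinh (u : R) : cosh u ^ 2 - sinh u ^ 2 = 1.
Proof.
  unfold cosh, sinh.
  assert (H : exp u * exp (- u) = 1)
    by (rewrite <- exp_plus, Rplus_opp_r; apply exp_0).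
  field_simplify. lra.
Qed.

Lemma sinh_pos (u : R) : 0 < u -> 0 < sinh u.
Proof. intros H. rewrite <- sinh_0. now apply sinh_lt. Qed.

Lemma cosh_pos (u : R) : 0 < cosh u.
Proof. unfold cosh. assert (H1 := exp_pos u). assert (H2 := exp_pos (- u)). lra. Qed.

(** Apply [polesum_limit] to [g t = sinh (a (PI - t))], then use
    [sinh (3 y) = sinh y (1 + 2 cosh (2 y))]. *)
Lemma polesum_hyperbolic (a : R) : 0 < a ->
  is_lim_seq (fun M => polesum (3 * M) (- a ^ 2))
    (hyp_value a).
Proof.
  intros Ha. unfold hyp_value. assert (HPI := PI_gt_3).
  assert (H3p : 0 < sqrt 3) by (apply sqrt_lt_R0; lra).
  set (y := PI * a / 3).
  assert (Hy : 0 < y) by (unfold y; nra).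
  assert (Hs3 : sinh (PI * a) = sinh y * (1 + 2 * cosh (2 * y))).
  { replace (PI * a) with (2 * y + y) by (unfold y; field).
    rewrite sinh_plus. replace (2 * y) with (y + y) at 1 by ring.
    rewrite sinh_plus, cosh_double. ring_simplify. ring. }
  assert (H2 := sinh_pos y Hy). assert (H4 := cosh_pos (2 * y)).
  replace (PI / (sqrt 3 * (1 + 2 * cosh (2 * y))))
    with (PI * sinh (a * (PI - 2 * PI / 3)) / (sqrt 3 * sinh (a * (PI - 0)))).
  - apply (polesum_limit (fun t => sinh (a * (PI - t)))
             (fun t => - a * cosh (a * (PI - t)))).
    + intros t. unfold sinh, cosh. auto_derive; [auto|]. unfold Rminus. field.
    + intros t. unfold sinh, cosh. auto_derive; [auto|]. unfold Rminus. field.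
    + rewrite Rminus_diag, Rmult_0_r. apply sinh_0.
    + replace (a * (PI - 0)) with (PI * a) by ring. rewrite Hs3. nra.
    + nra.
  - replace (a * (PI - 2 * PI / 3)) with y by (unfold y; field).
    replace (a * (PI - 0)) with (PI * a) by ring.
    rewrite Hs3. field. lra.
Qed.

(** * Uniform convergence of derivatives and integration along a path *)

Definition logsum (N : nat) (s : R) : R :=
  sum_f_R0 (fun n => chi n * (INR n * ln (1 - s / INR n ^ 2))) N.

Lemma logsum_0 (N : nat) : logsum N 0 = 0.
Proof.
  unfold logsum. apply sum_eq_R0. intros n _.
  unfold Rdiv. rewrite Rmult_0_l, Rminus_0_r, ln_1. ring.
Qed.

Lemma one_minus_pos (s : R) (n : nat) : s < 1 -> 0 < 1 - s / INR (S n) ^ 2.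
Proof.
  intros Hs. assert (Hn : 1 <= INR (S n)) by (apply (le_INR 1); lia).
  set (y := INR (S n)) in *.
  replace (1 - s / y ^ 2) with ((y ^ 2 - s) / y ^ 2) by (field; lra).
  apply Rdiv_lt_0_compat; nra.
Qed.

Lemma is_derive_logsum (N : nat) (s : R) : s < 1 ->
  is_derive (logsum N) s (- polesum N s).
Proof.
  intros Hs. unfold logsum, polesum. induction N as [|N IH].
  - simpl. apply (is_derive_ext (fun _ => 0)).
    + intros t. change (chi 0) with 0. symmetry. apply Rmult_0_l.
    + change (chi 0) with 0. rewrite Rmult_0_l, Ropp_0.
      apply (is_derive_const (V := R_NormedModule)).
  - rewrite tech5, Ropp_plus_distr.
    apply (is_derive_plus (V := R_NormedModule)
             (fun s => sum_f_R0 (fun n => chi n * (INR n * ln (1 - s / INR n ^ 2))) N)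
             (fun s => chi (S N) * (INR (S N) * ln (1 - s / INR (S N) ^ 2))));
      [exact IH|].
    assert (Hp := one_minus_pos s N Hs).
    assert (Hn : 1 <= INR (S N)) by (apply (le_INR 1); lia).
    set (y := INR (S N)) in *. clearbody y.
    auto_derive; [exact Hp|].
    field. split; [nra|]. lra.
Qed.

(** Uniform convergence of the derivatives at rate [O(1/N)].  The closed interval
    is needed for the mean value theorem, while the limit is only required in
    the open one because the evaluations of the series exclude [x = 0]. *)
Definition derivative_limit (X : R) (phi : nat -> R -> R) (d : R -> R) : Prop :=
  exists (phi' : nat -> R -> R) (C : R) (N0 : nat),
    (forall N x, 0 <= x <= X -> is_derive (phi N) x (phi' N x)) /\
    (forall N x, (N0 <= N)%nat -> 0 < x < X ->
       Rabs (phi' N x - d x) <= C / INR (S N)).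

Lemma derivative_limit_lin (X a b : R) (phi psi : nat -> R -> R) (d e : R -> R) :
  derivative_limit X phi d -> derivative_limit X psi e ->
  derivative_limit X (fun N x => a * phi N x + b * psi N x)
    (fun x => a * d x + b * e x).
Proof.
  intros (phi' & C1 & N1 & Hd1 & Hb1) (psi' & C2 & N2 & Hd2 & Hb2).
  exists (fun N x => a * phi' N x + b * psi' N x),
    (Rabs a * C1 + Rabs b * C2), (max N1 N2). split.
  - intros N x Hx.
    apply (is_derive_plus (V := R_NormedModule)
             (fun x => a * phi N x) (fun x => b * psi N x)).
    + apply (is_derive_scal (phi N)); auto.
    + apply (is_derive_scal (psi N)); auto.
  - intros N x HN Hx.
    specialize (Hb1 N x ltac:(lia) Hx). specialize (Hb2 N x ltac:(lia) Hx).
    replace (_ - _) with (a * (phi' N x - d x) + b * (psi' N x - e x)) by ring.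
    eapply Rle_trans; [apply Rabs_triang|]. rewrite !Rabs_mult.
    unfold Rdiv in *. rewrite Rmult_plus_distr_r, !Rmult_assoc.
    apply Rplus_le_compat; apply Rmult_le_compat_l; auto using Rabs_pos.
Qed.

(** The mean value theorem bounds the distance between [phi N X] and [Phi X]
    by [X] times the uniform distance of the derivatives, so the convergence of
    the functions themselves need not be known in advance. *)
Lemma primitive_limit (X : R) (phi : nat -> R -> R) (d Phi : R -> R) :
  0 < X -> derivative_limit X phi d ->
  (forall N, phi N 0 = 0) -> Phi 0 = 0 ->
  (forall x, 0 <= x <= X -> ex_derive Phi x) ->
  (forall x, 0 < x < X -> is_derive Phi x (d x)) ->
  is_lim_seq (fun N => phi N X) (Phi X).
Proof.
  intros HX (phi' & C & N0 & Hd & Hb) H0 HP0 HPc HPd.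
  assert (HE : forall N, (N0 <= N)%nat ->
            Rabs (phi N X - Phi X) <= X * C * / INR (S N)).
  { intros N HN.
    destruct (MVT_cor2 (fun x => phi N x - Phi x)
                (fun x => phi' N x - Derive Phi x) 0 X HX) as [c [Hc1 Hc2]].
    { intros c Hc. apply is_derive_Reals.
      apply (is_derive_minus (V := R_NormedModule) (phi N) Phi); [now apply Hd|].
      apply Derive_correct. now apply HPc. }
    rewrite H0, HP0, (is_derive_unique _ _ _ (HPd c Hc2)) in Hc1.
    replace (phi N X - Phi X) with ((phi' N c - d c) * X) by lra.
    rewrite Rabs_mult, (Rabs_pos_eq X) by lra.
    specialize (Hb N c HN Hc2). unfold Rdiv in Hb. nra. }
  apply is_lim_seq_ext with (fun N => Phi X + (phi N X - Phi X)); [intros; ring|].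
  replace (Finite (Phi X)) with (Finite (Phi X + 0)) by (f_equal; ring).
  apply is_lim_seq_plus'; [apply is_lim_seq_const|].
  apply is_lim_seq_abs_0.
  apply is_lim_seq_le_le_loc with (fun _ => 0) (fun N => X * C * / INR (S N)).
  - exists N0. intros N HN. split; [apply Rabs_pos | now apply HE].
  - apply is_lim_seq_const.
  - replace (Finite 0) with (Rbar_mult (X * C) 0) by (simpl; f_equal; ring).
    apply is_lim_seq_scal_l.
    replace (Finite 0) with (Rbar_inv p_infty) by reflexivity.
    apply is_lim_seq_inv; [|discriminate].
    apply (is_lim_seq_incr_1 INR). apply is_lim_seq_INR.
Qed.

(** On a compact path in [s < 1] the values stay in some [-A, B] with [B < 1],
    and there the error term of [polesum_tail] is at most
    [1 / ((1 - B) (N + 1))]. *)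
Lemma logsum_path (X : R) (p p' tau : R -> R) :
  0 < X ->
  (forall x, 0 <= x <= X -> is_derive p x (p' x)) ->
  (forall x, 0 <= x <= X -> continuous p' x) ->
  (forall x, 0 <= x <= X -> p x < 1) ->
  (forall x, 0 < x < X -> is_lim_seq (fun M => polesum (3 * M) (p x)) (tau x)) ->
  derivative_limit X (fun N x => logsum N (p x)) (fun x => - (p' x * tau x)).
Proof.
  intros HX Hd Hc Hp1 Htau.
  assert (Hpc : forall x, 0 <= x <= X -> continuous p x).
  { intros x Hx. apply (ex_derive_continuous (V := R_NormedModule)).
    eexists. now apply Hd. }
  destruct (bounded_on_segment p' 0 X ltac:(lra) Hc) as [D [HD HDb]].
  destruct (bounded_on_segment p 0 X ltac:(lra) Hpc) as [A [HA HAb]].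
  destruct (continuity_ab_maj p 0 X ltac:(lra)) as [x0 [Hx0 Hx0i]].
  { intros x Hx. apply continuity_pt_filterlim. now apply Hpc. }
  (* Keeping [B >= 0] gives [n^2 - s >= (1 - B) n^2] for all [s <= B]. *)
  set (B := Rmax 0 (p x0)).
  assert (HB : 0 <= B < 1).
  { unfold B. split; [apply Rmax_l|]. apply Rmax_lub_lt; [lra | now apply Hp1]. }
  assert (HpB : forall x, 0 <= x <= X -> p x <= B).
  { intros x Hx. eapply Rle_trans; [now apply Hx0 | apply Rmax_r]. }
  destruct (nfloor_ex A HA) as [N0 HN0].
  exists (fun N x => - (p' x * polesum N (p x))), (D / (1 - B)), N0. split.
  - intros N x Hx.
    replace (- (p' x * polesum N (p x))) with (scal (p' x) (- polesum N (p x)))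
      by (change (p' x * - polesum N (p x) = - (p' x * polesum N (p x))); ring).
    apply (is_derive_comp (V := R_NormedModule) (logsum N) p);
      [apply is_derive_logsum; now apply Hp1 | now apply Hd].
  - intros N x HN Hx.
    assert (Hn : INR N0 <= INR N) by now apply le_INR.
    assert (HA1 := HAb x ltac:(lra)). apply Rabs_le_between in HA1.
    assert (HB1 := HpB x ltac:(lra)). assert (HD1 := HDb x ltac:(lra)).
    assert (Ht := polesum_tail (p x) (tau x) N ltac:(lra)
                    ltac:(rewrite S_INR; lra) (Htau x Hx)).
    assert (Hn1 : 1 <= INR (S N)) by (apply (le_INR 1); lia).
    set (y := INR (S N)) in *.
    assert (Hfrac : y / (y ^ 2 - p x) <= / ((1 - B) * y)).
    { assert (0 < y ^ 2 - p x) by nra. assert (0 < (1 - B) * y) by nra.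
      apply Rminus_le_0.
      replace (/ ((1 - B) * y) - y / (y ^ 2 - p x))
        with ((B * y ^ 2 - p x) / ((1 - B) * y * (y ^ 2 - p x)))
        by (field; repeat split; lra).
      assert (0 <= B * (y ^ 2 - 1)) by (apply Rmult_le_pos; nra).
      apply Rdiv_le_0_compat; [lra | now apply Rmult_lt_0_compat]. }
    replace (_ - _) with (- (p' x * (polesum N (p x) - tau x))) by ring.
    rewrite Rabs_Ropp, Rabs_mult.
    replace (D / (1 - B) / y) with (D * / ((1 - B) * y)) by (field; lra).
    apply Rmult_le_compat; auto using Rabs_pos. lra.
Qed.

(** * The products as exponentials *)

(** The powers of [n] cancel in each factor, which becomes
    [(1 - p/n^2)^2 / ((1 - q/n^2)^2 (1 - r/n^2))]. *)
Lemma partial_prod_logsum (p q r : R) (N : nat) :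
  p < 1 -> q < 1 -> r < 1 ->
  partial_prod
    (fun n => powerRZ
       ((INR n ^ 2 * (INR n ^ 2 - p) ^ 2) / ((INR n ^ 2 - q) ^ 2 * (INR n ^ 2 - r)))
       (Z.of_nat n * legendre3 n)) N
  = exp (2 * logsum N p - 2 * logsum N q - logsum N r).
Proof.
  intros Hp Hq Hr. unfold logsum. induction N as [|N IH].
  - simpl. change (chi 0) with 0.
    replace (_ - _) with 0 by ring. now rewrite exp_0.
  - change (partial_prod ?f (S N)) with (partial_prod f N * f (S N)).
    cbv beta. rewrite IH, !tech5. clear IH.
    assert (HP := one_minus_pos p N Hp). assert (HQ := one_minus_pos q N Hq).
    assert (HR := one_minus_pos r N Hr).
    assert (Hn : 1 <= INR (S N)) by (apply (le_INR 1); lia).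
    assert (Hz : IZR (Z.of_nat (S N) * legendre3 (S N)) = INR (S N) * chi (S N)).
    { rewrite mult_IZR, <- INR_IZR_INZ. reflexivity. }
    set (y := INR (S N)) in *.
    set (P := 1 - p / y ^ 2) in *. set (Q := 1 - q / y ^ 2) in *.
    set (R0 := 1 - r / y ^ 2) in *.
    assert (Hbase : y ^ 2 * (y ^ 2 - p) ^ 2 / ((y ^ 2 - q) ^ 2 * (y ^ 2 - r))
                    = exp (2 * ln P - 2 * ln Q - ln R0)).
    { replace (2 * ln P - 2 * ln Q - ln R0)
        with (ln P + ln P + (- ln Q + (- ln Q + - ln R0))) by ring.
      rewrite !exp_plus, !exp_Ropp, !exp_ln by assumption.
      replace (y ^ 2 - p) with (y ^ 2 * P) by (unfold P; field; lra).
      replace (y ^ 2 - q) with (y ^ 2 * Q) by (unfold Q; field; lra).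
      replace (y ^ 2 - r) with (y ^ 2 * R0) by (unfold R0; field; lra).
      field. repeat split; lra. }
    rewrite Hbase, powerRZ_Rpower by apply exp_pos.
    unfold Rpower. rewrite ln_exp, Hz, <- exp_plus. f_equal. ring.
Qed.

Lemma partial_prod_ext (f g : nat -> R) (N : nat) :
  (forall n, f n = g n) -> partial_prod f N = partial_prod g N.
Proof. intros H. induction N as [|N IH]; simpl; [reflexivity | now rewrite IH, H]. Qed.

(** * The curve relating the two parameters *)

(** The solution [b] of [tan (PI b / 3) = K tanh (PI x / 3)] through the origin.
    The two constraints of the theorem are [K = 1 / sqrt 3] and
    [K = sqrt 3]. *)
Definition curve (K x : R) : R := 3 / PI * atan (K * tanh (PI * x / 3)).

Definition curve' (K x : R) : R :=
  K / (cosh (PI * x / 3) ^ 2 + K ^ 2 * sinh (PI * x / 3) ^ 2).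

Lemma curve_denom_pos (K u : R) : 0 < cosh u ^ 2 + K ^ 2 * sinh u ^ 2.
Proof. assert (H := cosh_pos u). nra. Qed.

Lemma is_derive_tanh (u : R) : is_derive tanh u (/ cosh u ^ 2).
Proof.
  assert (H := cosh_sinh u). assert (Hc := cosh_pos u).
  replace (/ cosh u ^ 2) with ((cosh u * cosh u - sinh u * sinh u) / cosh u ^ 2)
    by (replace (cosh u * cosh u - sinh u * sinh u) with 1 by lra; field; lra).
  apply (is_derive_div sinh cosh); [| |lra];
    apply is_derive_Reals; [apply derivable_pt_lim_sinh | apply derivable_pt_lim_cosh].
Qed.

Lemma is_derive_curve (K x : R) : is_derive (curve K) x (curve' K x).
Proof.
  assert (HPI := PI_gt_3). unfold curve, curve'.
  set (u := PI * x / 3). assert (Hc := cosh_pos u).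
  assert (HD := curve_denom_pos K u).
  replace (K / (cosh u ^ 2 + K ^ 2 * sinh u ^ 2))
    with (3 / PI * (PI / 3 * (K * / cosh u ^ 2) * / (1 + Rsqr (K * tanh u))))
    by (unfold tanh, Rsqr; field; repeat split; nra).
  apply (is_derive_scal (fun x => atan (K * tanh (PI * x / 3)))).
  apply (is_derive_comp (V := R_NormedModule) atan (fun x => K * tanh (PI * x / 3)));
    [apply is_derive_atan|].
  replace (PI / 3 * (K * / cosh u ^ 2)) with (K * (PI / 3 * / cosh u ^ 2)) by ring.
  apply (is_derive_scal (fun x => tanh (PI * x / 3))).
  apply (is_derive_comp (V := R_NormedModule) tanh (fun x => PI * x / 3));
    [apply is_derive_tanh|].
  auto_derive; [auto|field].
Qed.

Lemma continuous_curve' (K x : R) : continuous (curve' K) x.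
Proof.
  apply (ex_derive_continuous (V := R_NormedModule)). unfold curve'.
  assert (HD := curve_denom_pos K (PI * x / 3)). unfold cosh, sinh in *.
  auto_derive. unfold Rdiv, Rminus in *. simpl in *. repeat split; auto; try lra.
Qed.

Lemma curve'_pos (K x : R) : 0 < K -> 0 < curve' K x.
Proof. intros HK. apply Rdiv_lt_0_compat; [exact HK | apply curve_denom_pos]. Qed.

Lemma curve_0 (K : R) : curve K 0 = 0.
Proof.
  unfold curve, tanh. replace (PI * 0 / 3) with 0 by field.
  rewrite sinh_0. unfold Rdiv. rewrite Rmult_0_l, Rmult_0_r, atan_0. ring.
Qed.

Lemma curve_lt (K x y : R) : 0 < K -> x < y -> curve K x < curve K y.
Proof.
  intros HK Hxy.
  destruct (MVT_cor2 (curve K) (curve' K) x y Hxy) as [c [Hc _]].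
  { intros c _. apply is_derive_Reals, is_derive_curve. }
  assert (H := curve'_pos K c HK). nra.
Qed.

(** For [0 < b < 1] the angle [PI b / 3] is in the range of the arctangent, so
    the constraint determines [b]. *)
Lemma curve_value (K x b : R) : 0 < b < 1 ->
  K * tanh (PI * x / 3) = tan (PI * b / 3) -> curve K x = b.
Proof.
  intros Hb H. assert (HPI := PI_gt_3). unfold curve. rewrite H, atan_tan by nra.
  field. lra.
Qed.

Lemma cos_double_atan (v : R) : cos (2 * atan v) = (1 - v ^ 2) / (1 + v ^ 2).
Proof.
  assert (Ht := tan_atan v). assert (Hb := atan_bound v).
  assert (Hc : 0 < cos (atan v)) by (apply cos_gt_0; lra).
  rewrite cos_2a_cos. unfold tan in Ht.
  assert (H := sin2_cos2 (atan v)). unfold Rsqr in H.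
  assert (Hs : sin (atan v) = v * cos (atan v)) by (rewrite <- Ht at 2; field; lra).
  rewrite Hs in H.
  assert (Hv : 0 < 1 + v ^ 2) by nra.
  apply Rmult_eq_reg_r with (1 + v ^ 2); [|lra].
  replace ((1 - v ^ 2) / (1 + v ^ 2) * (1 + v ^ 2)) with (1 - v ^ 2) by (field; lra).
  lra.
Qed.

Lemma cos_double_curve (K x : R) :
  let u := PI * x / 3 in
  cos (2 * (PI * curve K x / 3)) =
  (cosh u ^ 2 - K ^ 2 * sinh u ^ 2) / (cosh u ^ 2 + K ^ 2 * sinh u ^ 2).
Proof.
  intros u. assert (HPI := PI_gt_3). assert (Hc := cosh_pos u).
  assert (HD := curve_denom_pos K u).
  replace (PI * curve K x / 3) with (atan (K * tanh u))
    by (unfold curve; fold u; field; lra).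
  rewrite cos_double_atan. unfold tanh. field. repeat split; nra.
Qed.

(** This and the next three identities are what the two constraints are for:
    the limits of the logarithmic derivatives become [curve' K] or its inverse,
    up to the factor [PI / 3].  With [w] the square of
    [sinh (PI x / 3)] each side is, up to a constant factor, a
    rational function of [w]. *)
Lemma hyp_value_inv_sqrt3 (x : R) :
  hyp_value x = PI / 3 * curve' (/ sqrt 3) x.
Proof.
  destruct sqrt3_facts as [H3 H33]. unfold hyp_value, curve'.
  set (u := PI * x / 3). rewrite cosh_double, pow_inv, H33.
  assert (Hc := cosh_pos u). assert (Hs := cosh_sinh u).
  replace (sinh u ^ 2) with (cosh u ^ 2 - 1) by lra.
  assert (1 <= cosh u ^ 2) by nra.
  field [H33]. repeat split; lra.
Qed.

Lemma trig_value_inv_sqrt3 (x : R) :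
  curve' (/ sqrt 3) x *
    (trig_value (curve (/ sqrt 3) x) + 2 * trig_value (2 * curve (/ sqrt 3) x))
  = PI / 3.
Proof.
  destruct sqrt3_facts as [H3 H33]. unfold trig_value, curve'.
  set (K := / sqrt 3). set (u := PI * x / 3).
  replace (PI * (2 * curve K x) / 3) with (2 * (PI * curve K x / 3)) by field.
  rewrite (cos_2a_cos (2 * _)).
  assert (HC := cos_double_curve K x). cbv zeta in HC. fold u in HC.
  rewrite HC. unfold K. rewrite pow_inv, H33.
  assert (Hs := cosh_sinh u).
  replace (cosh u ^ 2) with (1 + sinh u ^ 2) by lra.
  assert (0 <= sinh u ^ 2) by nra. set (w := sinh u ^ 2) in *. clearbody w.
  field [H33]. repeat split; nra.
Qed.

Lemma trig_value_sqrt3 (x : R) :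
  curve' (sqrt 3) x * trig_value (curve (sqrt 3) x) = PI / 3.
Proof.
  destruct sqrt3_facts as [H3 H33]. unfold trig_value, curve'.
  assert (HC := cos_double_curve (sqrt 3) x). cbv zeta in HC.
  set (u := PI * x / 3) in *. rewrite HC, H33.
  assert (Hs := cosh_sinh u).
  replace (cosh u ^ 2) with (1 + sinh u ^ 2) by lra.
  assert (0 <= sinh u ^ 2) by nra. set (w := sinh u ^ 2) in *. clearbody w.
  field [H33]. repeat split; nra.
Qed.

Lemma hyp_value_sqrt3 (x : R) :
  hyp_value x + 2 * hyp_value (2 * x) = PI / 3 * curve' (sqrt 3) x.
Proof.
  destruct sqrt3_facts as [H3 H33]. unfold hyp_value, curve'.
  replace (PI * (2 * x) / 3) with (2 * (PI * x / 3)) by field.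
  set (u := PI * x / 3). rewrite (cosh_double (2 * u)), cosh_double, H33.
  assert (Hs := cosh_sinh u).
  replace (cosh u ^ 2) with (1 + sinh u ^ 2) by lra.
  assert (0 <= sinh u ^ 2) by nra. set (w := sinh u ^ 2) in *. clearbody w.
  field [H33]. repeat split; nra.
Qed.

(** * Integration along the curve *)

Lemma derivative_limit_trig (K X c : R) :
  0 < K -> 0 < X -> 0 < c -> c * curve K X < 1 ->
  derivative_limit X (fun N x => logsum N ((c * curve K x) ^ 2))
    (fun x => - (2 * c ^ 2 * curve K x * curve' K x * trig_value (c * curve K x))).
Proof.
  intros HK HX Hc Hlt.
  assert (Hb0 : forall x, 0 < x -> 0 < curve K x).
  { intros x Hx. rewrite <- (curve_0 K). now apply curve_lt. }
  assert (HbX : forall x, 0 <= x <= X -> 0 <= c * curve K x < 1).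
  { intros x [H0 H1]. split.
    - destruct H0 as [H0|<-]; [specialize (Hb0 x H0); nra | rewrite curve_0; lra].
    - destruct H1 as [H1| ->]; [|lra]. assert (H := curve_lt K x X HK H1). nra. }
  apply (logsum_path X (fun x => (c * curve K x) ^ 2)
    (fun x => 2 * c ^ 2 * curve K x * curve' K x)
    (fun x => trig_value (c * curve K x)) HX).
  - intros x _. evar_last.
    + apply (is_derive_pow (fun x => c * curve K x) 2 x (c * curve' K x)).
      apply (is_derive_scal (curve K)), is_derive_curve.
    + simpl. ring.
  - intros x _.
    apply (continuous_mult (fun x => 2 * c ^ 2 * curve K x) (curve' K));
      [|apply continuous_curve'].
    apply (ex_derive_continuous (V := R_NormedModule)).
    eexists. apply (is_derive_scal (curve K)), is_derive_curve.
  - intros x Hx. specialize (HbX x Hx). nra.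
  - intros x Hx. apply polesum_trig. split.
    + apply Rmult_lt_0_compat; [exact Hc | apply Hb0; lra].
    + apply HbX. lra.
Qed.

Lemma derivative_limit_hyp (X c : R) : 0 < X -> 0 < c ->
  derivative_limit X (fun N x => logsum N (- (c * x) ^ 2))
    (fun x => 2 * c ^ 2 * x * hyp_value (c * x)).
Proof.
  intros HX Hc.
  destruct (logsum_path X (fun x => - (c * x) ^ 2) (fun x => - (2 * c ^ 2 * x))
    (fun x => hyp_value (c * x)) HX) as (phi' & C & N0 & Hd & Hb).
  - intros x _. auto_derive; [auto|ring].
  - intros x _. apply (ex_derive_continuous (V := R_NormedModule)).
    auto_derive. auto.
  - intros x _. nra.
  - intros x Hx. apply polesum_hyperbolic. nra.
  - exists phi', C, N0. split; [exact Hd|]. intros N x HN Hx.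
    replace (2 * c ^ 2 * x * hyp_value (c * x))
      with (- (- (2 * c ^ 2 * x) * hyp_value (c * x))) by ring.
    now apply Hb.
Qed.

Lemma is_derive_scal_id_mul_curve (k K x : R) :
  is_derive (fun x => k * (x * curve K x)) x (k * (curve K x + x * curve' K x)).
Proof.
  apply (is_derive_scal (fun x => x * curve K x)).
  evar_last.
  - apply (is_derive_mult (fun x => x) (curve K) x 1 (curve' K x));
      [apply (is_derive_id (K := R_AbsRing)) | apply is_derive_curve | exact Rmult_comm].
  - change (1 * curve K x + x * curve' K x = curve K x + x * curve' K x). ring.
Qed.

(** The limit of the derivatives is
    [4 x hyp_value x + 4 b b' (trig_value b + 2 trig_value (2 b))] with
    [b = curve K x] and [b' = curve' K x]; by the identities for
    [K = 1 / sqrt 3] it is [(4 PI / 3) (x b' + b)], the derivative of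
    [(4 PI / 3) x b]. *)
Lemma logsum_limit_inv_sqrt3 (X : R) : 0 < X -> 2 * curve (/ sqrt 3) X < 1 ->
  let b := curve (/ sqrt 3) X in
  is_lim_seq (fun N => 2 * logsum N (- X ^ 2) - 2 * logsum N (b ^ 2)
                       - logsum N ((2 * b) ^ 2))
    (4 * PI * X * b / 3).
Proof.
  intros HX Hlt b. set (K := / sqrt 3) in *.
  assert (HK : 0 < K) by (apply Rinv_0_lt_compat, sqrt3_facts).
  assert (Hb : 0 < b).
  { unfold b. rewrite <- (curve_0 K). now apply curve_lt. }
  fold b in Hlt.
  assert (HD := derivative_limit_lin X 1 (-1) _ _ _ _
    (derivative_limit_lin X 2 (-2) _ _ _ _
      (derivative_limit_hyp X 1 HX Rlt_0_1)
      (derivative_limit_trig K X 1 HK HX Rlt_0_1 ltac:(fold b; lra)))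
    (derivative_limit_trig K X 2 HK HX Rlt_0_2 Hlt)).
  assert (HL := primitive_limit X _ _ (fun x => 4 * PI / 3 * (x * curve K x)) HX HD).
  cbv beta in HL. fold b in HL.
  replace (4 * PI * X * b / 3) with (4 * PI / 3 * (X * b)) by field.
  eapply is_lim_seq_ext; [|apply HL].
  - intros N. simpl. rewrite !Rmult_1_l. ring.
  - intros N. rewrite curve_0, !Rmult_0_r.
    replace (0 ^ 2) with 0 by ring. rewrite Ropp_0, logsum_0. ring.
  - ring.
  - intros x _. eexists. apply is_derive_scal_id_mul_curve.
  - intros x _. evar_last; [apply is_derive_scal_id_mul_curve|].
    rewrite !Rmult_1_l.
    assert (H1 := hyp_value_inv_sqrt3 x). assert (H2 := trig_value_inv_sqrt3 x).
    fold K in H1, H2.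
    transitivity (4 * curve K x * (PI / 3) + 4 * PI / 3 * x * curve' K x); [field|].
    rewrite <- H2, H1. field.
Qed.

(** The same computation with the roles of the two parameters exchanged: the
    limit of the derivatives is
    [- 4 b b' trig_value b - 4 x (hyp_value x + 2 hyp_value (2 x))]. *)
Lemma logsum_limit_sqrt3 (X : R) : 0 < X -> curve (sqrt 3) X < 1 ->
  let b := curve (sqrt 3) X in
  is_lim_seq (fun N => 2 * logsum N (b ^ 2) - 2 * logsum N (- X ^ 2)
                       - logsum N (- (2 * X) ^ 2))
    (- (4 * PI * X * b / 3)).
Proof.
  intros HX Hlt b. set (K := sqrt 3) in *.
  assert (HK : 0 < K) by apply sqrt3_facts.
  assert (Hb : 0 < b).
  { unfold b. rewrite <- (curve_0 K). now apply curve_lt. }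
  fold b in Hlt.
  assert (HD := derivative_limit_lin X 1 (-1) _ _ _ _
    (derivative_limit_lin X 2 (-2) _ _ _ _
      (derivative_limit_trig K X 1 HK HX Rlt_0_1 ltac:(fold b; lra))
      (derivative_limit_hyp X 1 HX Rlt_0_1))
    (derivative_limit_hyp X 2 HX Rlt_0_2)).
  assert (HL := primitive_limit X _ _ (fun x => - (4 * PI / 3) * (x * curve K x)) HX HD).
  cbv beta in HL. fold b in HL.
  replace (- (4 * PI * X * b / 3)) with (- (4 * PI / 3) * (X * b)) by field.
  eapply is_lim_seq_ext; [|apply HL].
  - intros N. simpl. rewrite !Rmult_1_l. ring.
  - intros N. rewrite curve_0, !Rmult_0_r.
    replace (0 ^ 2) with 0 by ring. rewrite Ropp_0, logsum_0. ring.
  - ring.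
  - intros x _. eexists. apply is_derive_scal_id_mul_curve.
  - intros x _. evar_last; [apply is_derive_scal_id_mul_curve|].
    rewrite !Rmult_1_l.
    assert (H1 := hyp_value_sqrt3 x). assert (H2 := trig_value_sqrt3 x).
    fold K in H1, H2.
    transitivity (- 4 * curve K x * (PI / 3) - 4 * x * (PI / 3 * curve' K x)); [field|].
    rewrite <- H1, <- H2. field.
Qed.

Lemma infinite_prod_of_logsum (f : nat -> R) (p q r l : R) :
  p < 1 -> q < 1 -> r < 1 ->
  (forall n, f n = powerRZ
       ((INR n ^ 2 * (INR n ^ 2 - p) ^ 2) / ((INR n ^ 2 - q) ^ 2 * (INR n ^ 2 - r)))
       (Z.of_nat n * legendre3 n)) ->
  is_lim_seq (fun N => 2 * logsum N p - 2 * logsum N q - logsum N r) l ->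
  is_infinite_prod f (exp l).
Proof.
  intros Hp Hq Hr Hf Hl. unfold is_infinite_prod.
  apply is_lim_seq_ext with
    (fun N => exp (2 * logsum N p - 2 * logsum N q - logsum N r)).
  - intros N. rewrite (partial_prod_ext f _ N Hf). symmetry.
    now apply partial_prod_logsum.
  - apply (is_lim_seq_continuous exp _ l); [|exact Hl].
    apply derivable_continuous_pt, derivable_pt_exp.
Qed.

Theorem proposition10 : forall alpha : R, 0 < alpha ->
  (forall beta : R, 0 < beta < 1 / 2 ->
     tanh (PI * alpha / 3) = sqrt 3 * tan (PI * beta / 3) ->
     is_infinite_prod
       (fun n : nat =>
          powerRZ
            ((INR n ^ 2 * (INR n ^ 2 + alpha ^ 2) ^ 2) /
             ((INR n ^ 2 - beta ^ 2) ^ 2 * (INR n ^ 2 - 4 * beta ^ 2)))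
            (Z.of_nat n * legendre3 n))
       (exp (4 * PI * alpha * beta / 3)))
  /\
  (forall beta : R, 0 < beta < 1 ->
     tan (PI * beta / 3) = sqrt 3 * tanh (PI * alpha / 3) ->
     is_infinite_prod
       (fun n : nat =>
          powerRZ
            ((INR n ^ 2 * (INR n ^ 2 - beta ^ 2) ^ 2) /
             ((INR n ^ 2 + alpha ^ 2) ^ 2 * (INR n ^ 2 + 4 * alpha ^ 2)))
            (Z.of_nat n * legendre3 n))
       (exp (- (4 * PI * alpha * beta / 3)))).
Proof.
  intros alpha Ha. destruct sqrt3_facts as [H3 _]. split; intros beta Hb Heq.
  - assert (Hc : curve (/ sqrt 3) alpha = beta).
    { apply curve_value; [lra|]. rewrite Heq. field. lra. }
    assert (HL := logsum_limit_inv_sqrt3 alpha Ha). rewrite Hc in HL.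
    apply (infinite_prod_of_logsum _ (- alpha ^ 2) (beta ^ 2) ((2 * beta) ^ 2)).
    + nra.
    + nra.
    + nra.
    + intros n. f_equal. f_equal; [ring|]. f_equal. ring.
    + apply HL. lra.
  - assert (Hc : curve (sqrt 3) alpha = beta).
    { apply curve_value; [lra | now rewrite Heq]. }
    assert (HL := logsum_limit_sqrt3 alpha Ha). rewrite Hc in HL.
    apply (infinite_prod_of_logsum _ (beta ^ 2) (- alpha ^ 2) (- (2 * alpha) ^ 2)).
    + nra.
    + nra.
    + nra.
    + intros n. f_equal. f_equal. f_equal; ring.
    + apply HL. lra.
Qed.
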